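(* Let $d\ge 1$ be an integer and let $M\subset\mathcal{P}([d])$ be non-empty. There is a constant $K=K(d,M)>0$, depending only on $d$ and $M$, such that the following holds for all integers $l\ge 1$ and all positive integers $n_1,\dots,n_d$: if $A\subset[n_1]\times\dots\times[n_d]$ satisfies $\mathrm{c}_M(A)\ge l$, then there exist $X_1\subset[n_1],\dots,X_d\subset[n_d]$, each of size at most $K\cdot\max(|M|,d)^{dl}$, such that \[\mathrm{c}_M\big(A\cap(X_1\times\dots\times X_d)\big)\ge l.\]
   Context: $[k]=\{1,\dots,k\}$. For $B \subset [d]$, a $B$-subspace is a maximal subset $S$ of $[n_1]\times\dots\times[n_d]$ such that $x_i = y_i$ whenever $x,y\in S$ and $i \notin B$. For non-empty $M\subset\mathcal{P}([d])$, an $M$-subspace is a $B$-subspace for some $B\in M$. The $M$-covering number $\mathrm{c}_M(A)$ of $A\subset[n_1]\times\dots\times[n_d]$ is the smallest nonnegative integer $k$ such that $A$ is contained in a union of $k$ $M$-subspaces. (The paper writes the size bound as $O(\max(|M|,d)^{dl})$ with $d,M$ fixed and $l$ large.)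
   Formalization: The case d = 1, M = {∅} is excluded: there c_M(A) = |A| while max(|M|,d)^{dl} = 1, so X_1 would need at least l elements but at most K for every l, and the statement fails; all other pairs (d, M) are covered. *)

(* Defs.v *)
From HB Require Import structures.
From mathcomp Require Import all_boot.

Set Implicit Arguments.
Unset Strict Implicit.
Unset Printing Implicit Defensive.

(* [n i] is represented by 'I_(n i), so its elements are 0, ..., n i - 1. *)
Definition grid (d : nat) (n : 'I_d -> nat) : finType :=
  {dffun forall i : 'I_d, 'I_(n i)}.

Definition agree_off (d : nat) (n : 'I_d -> nat) (B : {set 'I_d})
    (S : {set grid n}) : bool :=
  [forall x in S, forall y in S, forall i, (i \notin B) ==> (x i == y i)].

Definition subspace (d : nat) (n : 'I_d -> nat) (B : {set 'I_d})
    (S : {set grid n}) : bool :=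
  maxset (@agree_off d n B) S.

Definition Msubspace (d : nat) (n : 'I_d -> nat) (M : {set {set 'I_d}})
    (S : {set grid n}) : bool :=
  [exists B in M, subspace B S].

Definition coverable (d : nat) (n : 'I_d -> nat) (M : {set {set 'I_d}})
    (A : {set grid n}) (k : nat) : bool :=
  [exists t : k.-tuple {set grid n},
     all (Msubspace M) t && (A \subset \bigcup_(S <- t) S)].

Lemma coverableP (d : nat) (n : 'I_d -> nat) (M : {set {set 'I_d}})
    (A : {set grid n}) (k : nat) :
  reflect (exists2 s : seq {set grid n},
             size s = k /\ {in s, forall S, Msubspace M S}
           & {in A, forall x, exists2 S, S \in s & x \in S})
          (coverable M A k).
Proof.
apply: (iffP existsP) => [[t /andP[/allP tM /subsetP At]]|[s [sk sM] As]].
  exists t; first by rewrite size_tuple.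
  move=> x /At; rewrite big_tnth => /bigcupP[i _ xi].
  by exists (tnth (in_tuple t) i); first exact: mem_tnth.
have sk' : size s == k by apply/eqP.
exists (Tuple sk') => /=; apply/andP; split; first exact/allP.
apply/subsetP => x /As[S Ss xS]; rewrite (big_rem S Ss) /=.
by rewrite inE xS.
Qed.

Lemma subspace_at (d : nat) (n : 'I_d -> nat) (B : {set 'I_d}) (x : grid n) :
  exists2 S : {set grid n}, subspace B S & x \in S.
Proof.
have [|S BS xS] := @maxset_exists _ (@agree_off d n B) [set x].
  apply/forall_inP => y /set1P->; apply/forall_inP => z /set1P->.
  by apply/forallP => i; rewrite eqxx implybT.
by exists S => //; apply: (subsetP xS); rewrite set11.
Qed.

Lemma coverable_ex (d : nat) (M : {set {set 'I_d}}) (M0 : M != set0)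
    (n : 'I_d -> nat) (A : {set grid n}) : exists k, coverable M A k.
Proof.
case/set0Pn: M0 => B BM.
pose s := [seq S <- enum {: {set grid n}} | Msubspace M S].
exists (size s); apply/coverableP; exists s.
  by split=> // S; rewrite mem_filter => /andP[].
move=> x _; have [S BS xS] := subspace_at B x; exists S => //.
by rewrite mem_filter mem_enum andbT; apply/existsP; exists B; rewrite BM.
Qed.

Definition cover_number (d : nat) (M : {set {set 'I_d}}) (M0 : M != set0)
    (n : 'I_d -> nat) (A : {set grid n}) : nat :=
  ex_minn (coverable_ex M0 A).

(* For d = 1 and M = {set0} the covering number is the cardinality, whereas
   maxn #|M| d = 1, so no constant bounds the sizes of the X i for all l: this
   pair (d, M) has to be excluded from the theorem. *)
Lemma cover_number_points (d : nat) (M0 : [set set0 : {set 'I_d}] != set0)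
    (n : 'I_d -> nat) (A : {set grid n}) : cover_number M0 A = #|A|.
Proof.
rewrite /cover_number; case: ex_minnP => k /coverableP[s [<- sM] As] kmin.
have sub1 S : Msubspace [set set0] S -> #|S : {set grid n}| <= 1.
  case/existsP=> B /andP[/set1P-> /maxsetp/forall_inP S1].
  apply/card_le1_eqP => x y xS yS; apply/ffunP => i; apply/eqP.
  by move/forall_inP: (S1 _ yS) => /(_ _ xS)/forallP/(_ i); rewrite inE.
apply/eqP; rewrite eqn_leq; apply/andP; split.
  apply: kmin; apply/coverableP; exists [seq [set x] | x <- enum A].
    split=> [|_ /mapP[x _ ->]]; first by rewrite size_map -cardE.
    have [S BS xS] := subspace_at set0 x.
    have MS : Msubspace [set set0] S by apply/existsP; exists set0; rewrite set11.
    suff <- : S = [set x] by [].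
    apply/eqP; rewrite eq_sym eqEcard sub1set xS cards1; exact: sub1.
  by move=> x xA; exists [set x]; rewrite ?set11 ?map_f ?mem_enum.
have AU : A \subset \bigcup_(S <- s) S.
  by apply/subsetP => x /As[S Ss xS]; rewrite (big_rem S Ss) /= inE xS.
apply: leq_trans (subset_leq_card AU) _.
elim: s sM {As kmin AU} => [|S s IHs] sM; first by rewrite big_nil cards0.
rewrite big_cons (leq_trans (leq_card_setU _ _)) //= -add1n leq_add //.
  by apply/sub1/sM; rewrite mem_head.
by apply: IHs => S' sS'; apply: sM; rewrite inE sS' orbT.
Qed.

Lemma points_on_line_unbounded (M0 : [set set0 : {set 'I_1}] != set0) :
  ~ exists K : nat, 0 < K /\
    forall l : nat, 1 <= l ->
    forall n : 'I_1 -> nat, (forall i, 0 < n i) ->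
    forall A : {set grid n}, l <= cover_number M0 A ->
    exists X : forall i : 'I_1, {set 'I_(n i)},
      (forall i, #|X i| <= K * maxn #|[set set0 : {set 'I_1}]| 1 ^ (1 * l)) /\
      l <= cover_number M0 (A :&: setXn X).
Proof.
case=> K [_ /(_ K.+1 isT (fun=> K.+1) (fun=> isT) setT)].
rewrite cover_number_points cardsT card_dep_ffun foldrE big_map big_enum /=.
rewrite big_ord1 card_ord => /(_ (leqnn _))[X [XK]].
rewrite cover_number_points setTI cardsXn big_ord1.
move/leq_trans/(_ (XK ord0)).
by rewrite cards1 maxnn exp1n muln1 ltnn.
Qed.

(* Main.v *)
Require Import Defs.
From mathcomp Require Import all_boot.

Set Implicit Arguments.
Unset Strict Implicit.
Unset Printing Implicit Defensive.

(** Branching on the way a point is covered: if a set is not covered by [k]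
    members of a family, pick a point [a] of it; a cover must use one of the at
    most [m] members [S] through [a], and then cover the points outside [S] with
    [k - 1] members.  Iterating produces a set of at most [1 + m + ... + m ^ k]
    points that is still not covered by [k] members.  At most [#|M|] of the
    [M]-subspaces contain a given point, and the [X i] are the projections of
    the set so obtained. *)

Definition covers (T : finType) (F : {set {set T}}) (A : {set T})
    (s : seq {set T}) : Prop :=
  {subset s <= F} /\ {in A, forall x, exists2 S, S \in s & x \in S}.

Lemma small_uncovered_subset (T : finType) (F : {set {set T}}) (m k : nat)
    (A : {set T}) :
  (forall x, #|[set S in F | x \in S]| <= m) ->
  (forall s, covers F A s -> k < size s) ->
  exists2 A' : {set T}, A' \subset A /\ #|A'| <= \sum_(i < k.+1) m ^ i
    & forall s, covers F A' s -> k < size s.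
Proof.
move=> Fm.
have uncovered_mem j (B : {set T}) :
    (forall s, covers F B s -> j < size s) -> exists a, a \in B.
  move=> jB; have [B0|[a aB]] := set_0Vmem B; last by exists a.
  suff /jB : covers F B [::] by [].
  by split=> // x; rewrite B0 inE.
elim: k A => [|k IHk] A kA.
  have [a aA] := uncovered_mem _ _ kA.
  exists [set a]; first by rewrite sub1set cards1 big_ord1.
  by case=> // -[_ /(_ a)]; rewrite set11 => /(_ isT)[].
have [a aA] := uncovered_mem _ _ kA.
(* [h S] is the set that the induction yields inside [A :\: S]; for [S] outside [F] it is the dummy
   [set0]. *)
have /fin_all_exists2[h hA hk] (S : {set T}) : exists2 A' : {set T},
    S \in F -> A' \subset A :\: S /\ #|A'| <= \sum_(i < k.+1) m ^ i
    & S \in F -> forall s, covers F A' s -> k < size s.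
  have [SF|] := boolP (S \in F); last by exists set0.
  have [|A' A'S A'k] := IHk (A :\: S); last by exists A'.
  (* Adding [S] to a cover of [A :\: S] gives a cover of [A], so one member is lost at most. *)
  move=> s [sF As]; apply: (kA (S :: s)); split=> [S'|x xA].
    by rewrite inE => /predU1P[->|/sF].
  have [xS|xS] := boolP (x \in S); first by exists S; rewrite ?mem_head.
  have [|S' S's xS'] := As x; first by rewrite inE xS.
  by exists S'; rewrite // inE S's orbT.
pose Fa := [set S in F | a \in S].
have FaF S : S \in Fa -> S \in F by rewrite inE => /andP[].
exists (a |: \bigcup_(S in Fa) h S); first split.
- rewrite subUset sub1set aA; apply/bigcupsP => S /FaF/hA[hS _].
  exact: subset_trans hS (subsetDl _ _).
- apply: leq_trans (leq_card_setU _ _) _; rewrite cards1 big_ord_recl /= leq_add2l.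
  under [leqRHS]eq_bigr => i _ do rewrite /bump leq0n add1n expnS.
  rewrite -big_distrr /=.
  have card_bigcup : #|\bigcup_(S in Fa) h S| <= \sum_(S in Fa) #|h S|.
    elim/big_rec2: _ => [|S n B _ nB]; first by rewrite cards0.
    by apply: leq_trans (leq_card_setU _ _) _; rewrite leq_add2l.
  apply: leq_trans card_bigcup _.
  apply: (@leq_trans (\sum_(S in Fa) \sum_(i < k.+1) m ^ i)).
    by apply: leq_sum => S /FaF/hA[].
  by rewrite sum_nat_const leq_mul2r Fm orbT.
(* The member [S] of the cover that contains [a] is of no help on [h S], which is disjoint from it;
   so the other members already cover [h S]. *)
- move=> s [sF As]; have [|S Ss aS] := As a; first by rewrite setU11.
  have SFa : S \in Fa by rewrite inE sF.
  rewrite (perm_size (perm_to_rem Ss)) /= ltnS; apply: (hk S (sF _ Ss)).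
  split=> [S' /mem_rem/sF //|x xh].
  have [|S' S's xS'] := As x.
    by apply/setU1P; right; apply/bigcupP; exists S.
  exists S' => //; move: S's; rewrite (perm_mem (perm_to_rem Ss)) inE.
  case/predU1P=> // SS'; have [/subsetP/(_ x xh)] := hA S (sF _ Ss).
  by rewrite inE -SS' xS'.
Qed.

Section Subspaces.

Variables (d : nat) (n : 'I_d -> nat).

Definition subspace_through (B : {set 'I_d}) (x : grid n) : {set grid n} :=
  [set y : grid n | [forall i, (i \notin B) ==> (y i == x i)]].

Lemma agree_off_subspace_through B x : agree_off B (subspace_through B x).
Proof.
apply/forall_inP => y; rewrite inE => /forallP yx.
apply/forall_inP => z; rewrite inE => /forallP zx.
apply/forallP => i; apply/implyP => iB.
by rewrite (eqP (implyP (yx i) iB)) (eqP (implyP (zx i) iB)).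
Qed.

(** Any set that agrees off [B] and contains [x] lies in [subspace_through B x], which itself agrees
    off [B]; maximality turns the inclusion into equality. *)
Lemma subspaceE B (S : {set grid n}) x :
  subspace B S -> x \in S -> S = subspace_through B x.
Proof.
case/maxsetP=> /forall_inP SB Smax xS; apply/esym/Smax.
  exact: agree_off_subspace_through.
apply/subsetP => y yS; rewrite inE.
by move/forall_inP: (SB y yS) => /(_ x xS).
Qed.

Lemma card_Msubspace_through (M : {set {set 'I_d}}) (x : grid n) :
  #|[set S in [set S | Msubspace M S] | x \in S]| <= #|M|.
Proof.
apply: leq_trans (leq_imset_card (subspace_through^~ x) M).
apply/subset_leq_card/subsetP => S; rewrite !inE => /andP[].
by case/existsP=> B /andP[BM BS] xS; apply/imsetP; exists B => //; apply: subspaceE.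
Qed.

(** Passes from the minimum to a bound on every cover, the form that [small_uncovered_subset] takes
    and returns. *)
Lemma leq_cover_number (M : {set {set 'I_d}}) (M0 : M != set0)
    (A : {set grid n}) (l : nat) :
  l <= cover_number M0 A <->
  forall s, covers [set S | Msubspace M S] A s -> l <= size s.
Proof.
rewrite /cover_number; case: ex_minnP => k /coverableP[s [<- sM] As] kmin.
split=> [ls t [tM At]|]; last by apply; split=> // S /sM; rewrite inE.
apply: leq_trans ls _; apply: kmin; apply/coverableP; exists t => //.
by split=> // S /tM; rewrite inE.
Qed.

(** The whole grid is then an [M]-subspace. This settles the case where [maxn #|M| d] is 1 and the
    size bound cannot grow with [l]. *)
Lemma cover_number_full (M : {set {set 'I_d}}) (M0 : M != set0)
    (A : {set grid n}) : setT \in M -> cover_number M0 A <= 1.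
Proof.
move=> TM; have /leq_cover_number := leqnn (cover_number M0 A).
move/(_ [:: setT]); apply; split=> [S|x _]; last first.
  by exists setT; rewrite ?mem_head ?inE.
rewrite !inE => /eqP->; apply/existsP; exists setT; rewrite TM.
apply/maxsetP; split=> [|S' _]; last by rewrite subTset => /eqP.
apply/forall_inP => x _; apply/forall_inP => y _.
by apply/forallP => i; rewrite inE.
Qed.

End Subspaces.

Lemma geometric_sum_leq (m l : nat) : 1 < m -> \sum_(i < l) m ^ i <= m ^ l.
Proof.
move=> m1; elim: l => [|l IHl]; first by rewrite big_ord0.
rewrite big_ord_recr /= expnS (leq_trans (leq_add IHl (leqnn _))) //.
by rewrite addnn -mul2n leq_mul2r m1 orbT.
Qed.

Theorem theorem2p7 (d : nat) (hd : 1 <= d) (M : {set {set 'I_d}})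
    (M0 : M != set0) (hdM : ~ (d = 1 /\ M = [set set0])) :
  exists K : nat, 0 < K /\
    forall l : nat, 1 <= l ->
    forall n : 'I_d -> nat, (forall i, 0 < n i) ->
    forall A : {set grid n}, l <= cover_number M0 A ->
    exists X : forall i : 'I_d, {set 'I_(n i)},
      (forall i, #|X i| <= K * maxn #|M| d ^ (d * l)) /\
      l <= cover_number M0 (A :&: setXn X).
Proof.
(* The constant 1 suffices; [l] is [k.+1], so the branching has depth [k]. *)
exists 1; split=> // -[//|k] _ n _ A kA.
have [A' [A'A A'k] kA'] := small_uncovered_subset
  (@card_Msubspace_through d n M) ((leq_cover_number M0 A k.+1).1 kA).
exists (fun i => [set (x : grid n) i | x in A']); split=> [i|]; last first.
  apply/leq_cover_number => s [sM As]; apply: kA'; split=> // x xA'.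
  apply: As; rewrite inE (subsetP A'A) //=; apply/setXnP => i.
  by apply/imsetP; exists x.
apply: leq_trans (leq_imset_card _ _) (leq_trans A'k _); rewrite mul1n.
(* The geometric sum is at most [b ^ l] only for a base [b] above 1; [b] will be [#|M|] or, if [M]
   is a singleton, [d]. *)
have powM b : 1 < b -> #|M| <= b -> b <= maxn #|M| d ->
    \sum_(j < k.+1) #|M| ^ j <= maxn #|M| d ^ (d * k.+1).
  move=> b1 Mb bmax; apply: (@leq_trans (b ^ k.+1)).
    apply: leq_trans (geometric_sum_leq k.+1 b1).
    by apply: leq_sum => -[[|j] jk] _ //; rewrite leq_exp2r.
  apply: (@leq_trans (maxn #|M| d ^ k.+1)); first by rewrite leq_exp2r.
  by rewrite leq_pexp2l ?leq_pmull // (leq_trans (ltnW b1)).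
have [M1|M1] := ltnP 1 #|M|; first by apply: (powM #|M|); rewrite ?leq_maxl.
have [d1|d1] := ltnP 1 d.
  by apply: (powM d); rewrite ?leq_maxr // (leq_trans M1) // ltnW.
(* Here [d] and [#|M|] are both 1. The excluded pair leaves only [M = [set setT]], so the covering
   number is at most 1, [k] is 0 and the sum is 1. *)
suff TM : setT \in M.
  have := leq_trans kA (cover_number_full M0 A TM).
  by case: (k) => // _; rewrite big_ord1 expn0 expn_gt0 leq_max hd orbT.
have dE : d = 1 by apply/eqP; rewrite eqn_leq d1.
have /cards1P[B MB] : #|M| == 1 by rewrite eqn_leq M1 card_gt0.
have [B0|[j jB]] := set_0Vmem B; first by case: hdM; rewrite MB B0.
rewrite MB inE eq_sym -subTset; apply/subsetP => j' _; suff -> : j' = j by [].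
by case: j j' {jB} => j jd [j' j'd]; apply: val_inj => /=; move: jd j'd;
  rewrite dE !ltnS !leqn0 => /eqP-> /eqP->.
Qed.
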